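(* Let $V$ be a simple vertex operator algebra and let $G$ be a finite group of automorphisms of $V$ (acting faithfully). Assume that $G$ is either abelian or dihedral. Then the map $H\mapsto V^H$ is a bijection from the set of subgroups $H$ of $G$ to the set of sub vertex operator algebras $W$ of $V$ with $V^G\subseteq W$.
   Context: A vertex operator algebra (VOA) $V=\coprod_{n\in\mathbb Z}V_n$ has vertex operators $Y(v,z)=\sum_{n\in\mathbb Z}v_nz^{-n-1}$, vacuum $\mathbf 1$ and Virasoro element $\omega$. $V$ is simple if the only subspaces of $V$ invariant under all $v_n$ ($v\in V$, $n\in\mathbb Z$) are $0$ and $V$. An automorphism of $V$ is an invertible linear map $g:V\to V$ with $gY(v,z)g^{-1}=Y(gv,z)$ for all $v\in V$, $g\mathbf 1=\mathbf 1$, $g\omega=\omega$. For a group $H$ of automorphisms, $V^H=\{v\in V: hv=v \ \forall h\in H\}$ is the subspace of $H$-invariants; it is a sub VOA. A sub VOA of $V$ is a graded subspace containing $\mathbf 1$ and $\omega$ and closed under all operations $u_n$, $u$ in the subspace, $n\in\mathbb Z$. *)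

(* Defs.v *)
(* Vertex operator algebras over the complex numbers C = R[i]
   (R : realType is the real numbers), encoded through their modes
   Y u n w = u_n w (so that Y(u,z) = sum_n u_n z^{-n-1}). *)
From HB Require Import structures.
From mathcomp Require Import all_boot all_order all_algebra all_fingroup all_solvable.
From mathcomp Require Import complex reals.
Set Implicit Arguments. Unset Strict Implicit. Unset Printing Implicit Defensive.
Import Order.TTheory GRing.Theory Num.Theory.
Local Open Scope ring_scope.

Section VOA.
Variable R : realType.
Local Notation C := (R[i]).
Variable V : lmodType C.

Definition binz (l : int) (i : nat) : C :=
  (\prod_(j < i) (l%:~R - (j%:R : C))) / (i`!)%:R.

(* V = coprod_n V_n with projections pi n : V -> V_n; the homogeneous space
   V_n is {v | pi n v = v}. *)
Definition is_grading (pi : int -> V -> V) : Prop :=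
  [/\ (forall n a u v, pi n (a *: u + v) = a *: pi n u + pi n v),
      (forall m n v, pi m (pi n v) = if m == n then pi n v else 0),
      (forall v, exists s : seq int,
          (forall n, n \notin s -> pi n v = 0) /\ v = \sum_(n <- s) pi n v) &
      (forall n, exists s : seq V, forall v, pi n v = v ->
          exists a : 'I_(size s) -> C, v = \sum_(i < size s) a i *: s`_i) ] /\
      (exists N : int, forall n v, n < N -> pi n v = 0).


Definition Vir (Y : V -> int -> V -> V) (omega : V) (n : int) : V -> V :=
  Y omega (n + 1).

(* Jacobi identity in components (Borcherds identity); both sums are finite
   by truncation, and we require equality of all sufficiently long partial
   sums. *)
Definition jacobi_identity (Y : V -> int -> V -> V) : Prop :=
  forall (u v w : V) (m n l : int), exists N : nat, forall M : nat, (N <= M)%N ->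
    \sum_(i < M) binz m i *: Y (Y u (l + i%:Z) v) (m + n - i%:Z) w =
    \sum_(i < M) ((-1) ^+ i * binz l i) *:
        (Y u (l + m - i%:Z) (Y v (n + i%:Z) w)
         - ((-1 : C) ^ l) *: Y v (l + n - i%:Z) (Y u (m + i%:Z) w)).

Definition is_VOA (pi : int -> V -> V) (Y : V -> int -> V -> V)
    (one omega : V) (c : C) : Prop :=
  ([/\ is_grading pi,
      (forall a u u' n w, Y (a *: u + u') n w = a *: Y u n w + Y u' n w),
      (forall u n a w w', Y u n (a *: w + w') = a *: Y u n w + Y u n w'),
      (forall u v, exists N : int, forall n, N <= n -> Y u n v = 0) &
      [/\ (* vacuum: Y(1,z) = id *)
          (forall n v, Y one n v = if n == -1 then v else 0),
          (* creation: Y(v,z)1 in V[[z]] with constant term v *)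
          (forall v, Y v (-1) one = v),
          (forall v n, 0 <= n -> Y v n one = 0) &
          jacobi_identity Y ] ]) /\
  ([/\
      (forall m n w, Vir Y omega m (Vir Y omega n w) - Vir Y omega n (Vir Y omega m w)
         = (m - n)%:~R *: Vir Y omega (m + n) w
           + (if m + n == 0 then ((m ^+ 3 - m)%:~R / 12%:R * c) *: w else 0)),
      (forall n v, pi n v = v -> Vir Y omega 0 v = n%:~R *: v) &
      (* L(-1)-derivative property: Y(L(-1)u,z) = d/dz Y(u,z) *)
      (forall u n w, Y (Vir Y omega (-1) u) n w = - (n%:~R *: Y u (n - 1) w))]).

Definition is_subspace (S : V -> Prop) : Prop :=
  S 0 /\ forall a u v, S u -> S v -> S (a *: u + v).

Definition simple_VOA (Y : V -> int -> V -> V) : Prop :=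
  forall S : V -> Prop, is_subspace S ->
    (forall v w n, S w -> S (Y v n w)) ->
    (forall v, S v -> v = 0) \/ (forall v, S v).

Definition is_VOA_aut (Y : V -> int -> V -> V) (one omega : V) (g : V -> V) : Prop :=
  [/\ (forall a u v, g (a *: u + v) = a *: g u + g v),
      bijective g,
      (forall u n v, g (Y u n v) = Y (g u) n (g v)),
      g one = one & g omega = omega].

Definition is_subVOA (pi : int -> V -> V) (Y : V -> int -> V -> V)
    (one omega : V) (W : V -> Prop) : Prop :=
  [/\ is_subspace W,
      (forall n w, W w -> W (pi n w)),
      W one, W omega &
      (forall u v n, W u -> W v -> W (Y u n v))].

End VOA.

Definition fixed_points (gT : finGroupType) (R : realType) (V : lmodType R[i])
    (rho : gT -> V -> V) (H : {set gT}) : V -> Prop :=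
  fun v => forall h, h \in H -> rho h v = v.

Definition dihedral (gT : finGroupType) (G : {set gT}) : bool :=
  [&& (4 <= #|G|)%N, ~~ odd #|G| & G \isog 'D_#|G|].

(* Main.v *)
(** Families [(d_g)] of vectors indexed by [G] form again a vertex algebra, with
    coordinatewise modes.  The argument is Artin's proof of the Galois
    correspondence: for [W] containing [V^G], a subspace [D] of families that is
    stable under the modes of all constant families and of the families
    [(g u)_g] with [u] in [W], and that contains the constant family [1], contains
    families vanishing outside the stabiliser [H] of [W] in [G] and equal on [H]
    to an arbitrary vector [x].  For [D] the set of [d] such that
    [T (a_p d) = sum_g g ((a_p d)_(g^-1))] lies in [W] for all [a] and [p], this
    gives [#|H| x] in [W] for every [x] in [V^H], that is, [W = V^H].
    Injectivity is the same argument with a linear functional in place of [T]. *)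
Require Import Defs.
From HB Require Import structures.
From mathcomp Require Import all_boot all_order all_algebra all_fingroup all_solvable.
From mathcomp Require Import complex reals boolp zify.
Import Order.TTheory GRing.Theory Num.Theory.
Local Open Scope ring_scope.

(** * Linear maps, and subspaces given as predicates *)

Section LinearMap.
Context {R : realType} {M N : lmodType R[i]} {f : M -> N}.
Hypothesis f_lin : forall a u v, f (a *: u + v) = a *: f u + f v.

Lemma lin0 : f 0 = 0.
Proof. by have /eqP := f_lin (- 1) 0 0; rewrite scaler0 addr0 scaleN1r addNr => /eqP. Qed.

Lemma linD u v : f (u + v) = f u + f v.
Proof. by rewrite -[u]scale1r f_lin !scale1r. Qed.

Lemma linZ a u : f (a *: u) = a *: f u.
Proof. by rewrite -[a *: u]addr0 f_lin lin0 addr0. Qed.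

Lemma linB u v : f (u - v) = f u - f v.
Proof. by rewrite linD -scaleN1r linZ scaleN1r. Qed.

Lemma lin_sum (I : Type) (r : seq I) (Q : pred I) (F : I -> M) :
  f (\sum_(i <- r | Q i) F i) = \sum_(i <- r | Q i) f (F i).
Proof. by apply: (big_morph f linD lin0). Qed.

End LinearMap.

Section Subspace.
Context {R : realType} {M : lmodType R[i]} {P : M -> Prop}.
Hypothesis Psub : is_subspace P.

Lemma subspace0 : P 0. Proof. by case: Psub. Qed.

Lemma subspaceD u v : P u -> P v -> P (u + v).
Proof. by move=> Pu Pv; rewrite -[u]scale1r; apply Psub.2. Qed.

Lemma subspaceZ a u : P u -> P (a *: u).
Proof. by move=> Pu; rewrite -[_ *: _]addr0; apply: Psub.2 => //; apply: subspace0. Qed.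

Lemma subspaceB u v : P u -> P v -> P (u - v).
Proof. by move=> Pu Pv; apply: subspaceD => //; rewrite -scaleN1r; apply: subspaceZ. Qed.

Lemma subspace_sum (I : Type) (r : seq I) (Q : pred I) (F : I -> M) :
  (forall i, Q i -> P (F i)) -> P (\sum_(i <- r | Q i) F i).
Proof. by move=> PF; elim/big_ind: _ => //; [exact: subspace0 | exact: subspaceD]. Qed.

Lemma subspace_head n (F : 'I_n.+1 -> M) :
  P (\sum_(i < n.+1) F i) -> (forall i : 'I_n, P (F (lift ord0 i))) -> P (F ord0).
Proof.
rewrite big_ord_recl => PS PF; rewrite -[F ord0](addrK (\sum_(i < n) F (lift ord0 i))).
by apply: subspaceB => //; apply: subspace_sum.
Qed.

End Subspace.

(** * Consequences of the Jacobi identity *)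

(** The axioms used both for [V] and for families of vectors, so that the Jacobi arguments apply to
    both. *)
Definition mode_algebra {R : realType} {M : lmodType R[i]} (Y : M -> int -> M -> M) : Prop :=
  [/\ (forall a u u' n w, Y (a *: u + u') n w = a *: Y u n w + Y u' n w),
      (forall u n a w w', Y u n (a *: w + w') = a *: Y u n w + Y u n w'),
      (forall u v, exists N : int, forall n, N <= n -> Y u n v = 0) &
      jacobi_identity Y].

Lemma binz0 (R : realType) l : binz R l 0 = 1.
Proof. by rewrite /binz big_ord0 divr1. Qed.

(** Truncation covers the large indices of a mode; the Jacobi identity then reduces an index to
    larger ones. *)
Lemma int_down_ind (P : int -> Prop) (N : int) :
  (forall n, N <= n -> P n) ->
  (forall n, (forall m, n < m -> P m) -> P n) -> forall n, P n.
Proof.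
move=> Pbig Pstep n.
suff H k m : N - k%:Z <= m -> P m by apply: (H `|N - n|%N); rewrite lerBlDr -lerBlDl; apply: lez_abs.
elim: k m => [|k IHk] m; first by rewrite subr0; apply: Pbig.
move=> le_m; apply: Pstep => m' lt_m; apply: IHk.
by move: le_m lt_m; lia.
Qed.

Section ModeAlgebra.
Context {R : realType} {M : lmodType R[i]} {Y : M -> int -> M -> M}.
Hypothesis Ymode : mode_algebra Y.

Lemma mode_linl n w a u v : Y (a *: u + v) n w = a *: Y u n w + Y v n w.
Proof. by case: Ymode. Qed.

Lemma mode_linr u n a v w : Y u n (a *: v + w) = a *: Y u n v + Y u n w.
Proof. by case: Ymode. Qed.

Lemma mode0l n w : Y 0 n w = 0. Proof. exact: (lin0 (mode_linl n w)). Qed.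

Lemma mode0r u n : Y u n 0 = 0. Proof. exact: (lin0 (mode_linr u n)). Qed.

Variable P : M -> Prop.
Hypothesis Psub : is_subspace P.

(* The Jacobi identity with [m] so large that [a_(m+i) d = 0] expresses
   [a_p (b_q d)] through iterates and the products [a_(p-i) (b_(q+i) d)]. *)
Lemma mode_assoc_subspace a b d :
  (forall s t, P (Y (Y a s b) t d)) -> forall p q, P (Y a p (Y b q d)).
Proof.
have [_ _ Ytr Yjac] := Ymode => Pab p q; move: q p.
have [N1 bN] := Ytr b d; have [N2 aN] := Ytr a d.
(* The induction on [q] is uniform in [p]: the terms after the leading one are multiples of a_(p-i)
   (b_(q+i) d) with i > 0. *)
apply: (@int_down_ind _ N1) => [q leNq p | q IH p].
  by rewrite bN // mode0r; apply: subspace0.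
have [N /(_ N.+1 (leqnSn N)) jac] := Yjac a b d N2 q (p - N2).
have aN' i : Y a (N2 + i%:Z) d = 0 by apply: aN; rewrite lerDl.
set F := fun i : 'I_N.+1 => ((-1) ^+ i * binz R (p - N2) i) *: Y a (p - i%:Z) (Y b (q + i%:Z) d).
suff: P (F ord0) by rewrite /F expr0 mul1r binz0 scale1r subr0 addr0.
apply: (subspace_head Psub) => [|i]; last first.
  by apply: (subspaceZ Psub); apply: IH; rewrite ltrDl.
rewrite (_ : \sum_i _ = \sum_(i < N.+1) binz R N2 i *: Y (Y a (p - N2 + i%:Z) b) (N2 + q - i%:Z) d).
  by apply: (subspace_sum Psub) => i _; apply: (subspaceZ Psub).
rewrite jac; apply: eq_bigr => i _.
by rewrite aN' mode0r scaler0 subr0 subrK.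
Qed.

(* The Jacobi identity with [l] so large that [a_(l+i) b = 0] is locality of [a] and [b]. *)
Lemma mode_swap_subspace a b d :
  (forall p q, P (Y a p (Y b q d))) -> forall p q, P (Y b p (Y a q d)).
Proof.
have [_ _ Ytr Yjac] := Ymode => Pab p q; move: q p.
have [N1 aN] := Ytr a d; have [L abL] := Ytr a b.
apply: (@int_down_ind _ N1) => [q leNq p | q IH p].
  by rewrite aN // mode0r; apply: subspace0.
have [N /(_ N.+1 (leqnSn N)) jac] := Yjac a b d q (p - L) L.
have ab0 i : Y a (L + i%:Z) b = 0.
  by apply: abL; rewrite lerDl.
set F := fun i : 'I_N.+1 => ((-1) ^+ i * binz R L i) *:
   (Y a (L + q - i%:Z) (Y b (p - L + i%:Z) d)
     - ((-1 : R[i]) ^ L) *: Y b (L + (p - L) - i%:Z) (Y a (q + i%:Z) d)).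
have PF0: P (F ord0).
  apply: (subspace_head Psub) => [|i].
    rewrite -jac big1 => [|i _]; first exact: subspace0.
    by rewrite ab0 mode0l scaler0.
  apply: (subspaceZ Psub); apply: (subspaceB Psub) => //; apply: (subspaceZ Psub).
  by apply: IH; rewrite ltrDl.
(* The leading term is a_(L+q) (b_(p-L) d) - (-1)^L b_p (a_q d); its first part lies in [P] by
   hypothesis, and the sign is invertible. *)
have := subspaceB Psub _ _ (Pab (L + q) (p - L)) PF0.
rewrite /F /= expr0 mul1r binz0 scale1r !subr0.
rewrite opprB addrCA subrr addr0 => /(subspaceZ Psub ((-1) ^ (- L)) _).
by rewrite scalerA -expfzDr ?oppr_eq0 ?oner_eq0 // addNr expr0z scale1r [L + _]addrC subrK.
Qed.


End ModeAlgebra.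

(** * Families of vectors with coordinatewise modes *)

Section Families.
Context {R : realType} {V : lmodType R[i]} {K : finType}.

Definition family_mode (Y : V -> int -> V -> V) (u : {ffun K -> V}) (n : int)
    (d : {ffun K -> V}) : {ffun K -> V} :=
  [ffun k => Y (u k) n (d k)].

(** As [K] is finite, the bounds for truncation and for the Jacobi sums can be chosen common to all
    coordinates. *)
Lemma family_mode_algebra (Y : V -> int -> V -> V) :
  mode_algebra Y -> mode_algebra (family_mode Y).
Proof.
case=> [YL YR Ytr Yjac]; split=> [a u u' n w|u n a w w'|u v|u v w m n l].
- by apply/ffunP=> k; rewrite !ffunE YL.
- by apply/ffunP=> k; rewrite !ffunE YR.
- have [N HN] := fin_all_exists (fun k => Ytr (u k) (v k)).
  exists (\sum_k `|N k|) => n len; apply/ffunP=> k; rewrite !ffunE HN //.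
  apply: le_trans len; rewrite (bigD1 k) //= (le_trans (ler_norm _)) // lerDl.
  by rewrite sumr_ge0.
- have [N HN] := fin_all_exists (fun k => Yjac (u k) (v k) (w k) m n l).
  exists (\max_k N k) => B leB; apply/ffunP=> k; rewrite !sum_ffunE.
  have /HN jac : (N k <= B)%N by apply: leq_trans leB; apply: leq_bigmax.
  under eq_bigr => i _ do rewrite !ffunE.
  by rewrite jac; apply: eq_bigr => i _; rewrite !ffunE.
Qed.

Lemma family_mode_const Y (a b : V) n :
  family_mode Y [ffun=> a] n [ffun=> b] = [ffun=> Y a n b].
Proof. by apply/ffunP=> k; rewrite !ffunE. Qed.

End Families.

(** * Simplicity and the group action *)

Section Galois.
Context {R : realType} {V : lmodType R[i]}.
Variables (Y : V -> int -> V -> V) (one omega : V).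
Hypothesis Ymode : mode_algebra Y.
Hypothesis vacuum : forall n v, Y one n v = if n == -1 then v else 0.
Hypothesis creation : forall v, Y v (-1) one = v.
Hypothesis Ysimple : simple_VOA Y.

Lemma zero_subspace : is_subspace (fun v : V => v = 0).
Proof. by split=> // a u v -> ->; rewrite scaler0 addr0. Qed.

(** By locality, the vectors killed by all modes of [u] form an invariant subspace. If it is all of
    [V], it contains [one], and u = u_(-1) 1 = 0. *)
Lemma mode_neq0 u v : u != 0 -> v != 0 -> exists n, Y u n v != 0.
Proof.
move=> u0 v0; apply: contrapT => noN.
have uv0 n : Y u n v = 0 by apply: contrapT => /eqP uv; apply: noN; exists n.
have [|w a q Sw n|S0|/(_ one) /(_ (-1))] := Ysimple (fun w => forall n, Y u n w = 0).
- split=> [n|a x y Sx Sy n]; first exact: (mode0r Ymode).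
  by rewrite (mode_linr Ymode) Sx Sy scaler0 addr0.
- apply: (mode_swap_subspace Ymode _ zero_subspace) => p q'.
  by rewrite Sw (mode0r Ymode).
- by case/eqP: v0; apply: S0.
- by rewrite creation; apply/eqP.
Qed.

Context {gT : finGroupType} {G : {group gT}} {rho : gT -> V -> V}.
Hypothesis rho_aut : forall g, g \in G -> is_VOA_aut Y one omega (rho g).
Hypothesis rhoM : forall g h v, g \in G -> h \in G -> rho (g * h)%g v = rho g (rho h v).

Lemma rho_lin g : g \in G -> forall a u v, rho g (a *: u + v) = a *: rho g u + rho g v.
Proof. by case/rho_aut. Qed.

Lemma rho_mode g u n v : g \in G -> rho g (Y u n v) = Y (rho g u) n (rho g v).
Proof. by case/rho_aut. Qed.

Lemma rho_one g : g \in G -> rho g one = one.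
Proof. by case/rho_aut. Qed.

Lemma rho1 v : rho 1%g v = v.
Proof.
have [_ /bij_inj inj_rho _ _ _] := rho_aut _ (group1 G).
by apply: inj_rho; rewrite -rhoM // mulg1.
Qed.

Lemma trace_fixed (H : {group gT}) v : H \subset G ->
  fixed_points rho H (\sum_(h in H) rho h v).
Proof.
move=> /subsetP sHG g Hg; rewrite (lin_sum (rho_lin _ (sHG _ Hg))) [RHS](reindex_inj (mulgI g)) /=.
by apply: eq_big => h; rewrite ?groupMl // => Hh; rewrite rhoM ?sHG.
Qed.

(** The default 0 outside [G] keeps these families closed under modes. *)
Definition orbit_family (u : V) : {ffun gT -> V} := [ffun k => if k \in G then rho k u else (0 : V)].

Lemma orbit_family_mode u n v :
  family_mode Y (orbit_family u) n (orbit_family v) = orbit_family (Y u n v).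
Proof.
by apply/ffunP=> k; rewrite !ffunE; case: ifP => Gk; rewrite ?rho_mode // (mode0l Ymode).
Qed.

(** Simplicity as defined admits V = 0; this handles that case. *)
Lemma mode_one0 (v : V) : one = 0 -> v = 0.
Proof. by move=> one0; rewrite -(creation v) one0 (mode0r Ymode). Qed.

(** * Separating the stabiliser of [W] from other group elements *)

Section Separation.
Variables (W : V -> Prop) (D : {ffun gT -> V} -> Prop).
Hypothesis Dsub : is_subspace D.
Hypothesis Dconst : forall a n d, D d -> D (family_mode Y [ffun=> a] n d).
Hypothesis Dorbit : forall u n d, W u -> D d -> D (family_mode Y (orbit_family u) n d).
Hypothesis Done : D [ffun=> one].

(* Applying [(k u - g u)_n] in each coordinate [k], for [u] in [W] moved by [g],
   kills the coordinate [g] and acts by the same nonzero mode on all the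
   coordinates in the stabiliser of [W]. *)
Lemma separate_seq (s : seq gT) : one != 0 ->
  (forall g, g \in s -> g \in G /\ exists2 u, W u & rho g u != u) ->
  exists x d, [/\ x != 0, D d, forall g, g \in s -> d g = 0 &
    forall h, h \in G -> (forall w, W w -> rho h w = w) -> d h = x].
Proof.
move=> one0; elim: s => [_|g s IH sP].
  by exists one, [ffun=> one]; split=> // h; rewrite ffunE.
have [|x [d [x0 Dd ds dH]]] := IH; first by move=> k ks; apply: sP; rewrite inE ks orbT.
have [Gg [u Wu gu]] := sP g (mem_head _ _).
have [|n uxn] := mode_neq0 (u - rho g u) x _ x0; first by rewrite subr_eq0 eq_sym.
exists (Y (u - rho g u) n x).
exists (family_mode Y (orbit_family u) n d - family_mode Y [ffun=> rho g u] n d).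
split=> //.
- apply: (subspaceB Dsub); [exact: Dorbit | exact: Dconst].
- move=> k; rewrite inE !ffunE => /predU1P[->|/ds ->]; first by rewrite Gg subrr.
  by rewrite !(mode0r Ymode) // subrr.
- by move=> h Gh hW; rewrite !ffunE Gh hW // dH // (linB (mode_linl Ymode n x)).
Qed.

(** The admissible values [x] form a subspace invariant under all modes, because [D] is stable under
    constant families. [separate_seq] makes it nonzero, so by simplicity it is [V]. *)
Lemma separate (S : {set gT}) x : S \subset G ->
  (forall g, g \in S -> exists2 u, W u & rho g u != u) ->
  exists d, [/\ D d, forall g, g \in S -> d g = 0 &
    forall h, h \in G -> (forall w, W w -> rho h w = w) -> d h = x].
Proof.
move=> /subsetP sSG SP.
have [/mode_one0 V0|one0] := eqVneq one 0.
  by exists [ffun=> one]; split=> // h _ _; rewrite (V0 x); apply: V0.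
have [|y [e [y0 De eS eH]]] := separate_seq (enum S) one0.
  by move=> g; rewrite mem_enum => Sg; split; [apply: sSG | apply: SP].
pose J x := exists d, [/\ D d, forall g, g \in S -> d g = 0 &
    forall h, h \in G -> (forall w, W w -> rho h w = w) -> d h = x].
have Jy : J y by exists e; split=> // g Sg; apply: eS; rewrite mem_enum.
have [|a z n [d [Dd dS dH]]|J0|] := Ysimple J; last exact.
- split=> [|a u v [d [Dd dS dH]] [d' [Dd' dS' dH']]].
    by exists 0; split=> [|g _|h _ _]; rewrite ?ffunE //; apply: (subspace0 Dsub).
  exists (a *: d + d'); split=> [|g Sg|h Gh hW]; first exact: Dsub.2.
    by rewrite !ffunE dS // dS' // scaler0 addr0.
  by rewrite !ffunE dH // dH'.
- exists (family_mode Y [ffun=> a] n d); split=> [|g Sg|h Gh hW]; first exact: Dconst.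
    by rewrite !ffunE dS // (mode0r Ymode).
  by rewrite !ffunE dH.
- by case/eqP: y0; apply: J0.
Qed.

End Separation.

(** * Injectivity of the correspondence *)

(** By faithfulness the pointwise stabiliser of [V] is trivial, so separation with W = V gives
    families supported, within [G], at 1 alone. An element of [H] outside [K] would then force V =
    0, hence be trivial by faithfulness. *)
Lemma fixed_points_inj (H K : {group gT}) :
  (forall g, g \in G -> (forall v, rho g v = v) -> g = 1%g) ->
  H \subset G -> K \subset G ->
  (forall v, fixed_points rho K v -> fixed_points rho H v) -> H \subset K.
Proof.
move=> faithful sHG sKG KH; apply/subsetP=> h Hh; apply: contraT => nKh.
have GK k : k \in K -> k \in G := subsetP sKG k.
have Gh := subsetP sHG _ Hh; (* As [h] fixes [V^K], this functional kills all families [(g v)_g]. *)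
pose L (d : {ffun gT -> V}) := \sum_(k in K) d k - \sum_(k in K) d (h * k)%g.
have L_lin a d d' : L (a *: d + d') = a *: L d + L d'.
  rewrite /L scalerBr !scaler_sumr addrACA -opprD -!big_split /=.
  by congr (_ - _); apply: eq_bigr => k _; rewrite !ffunE.
have Lsub : is_subspace (fun d => L d = 0).
  split=> [|a d d' Ld Ld']; last by rewrite L_lin Ld Ld' scaler0 addr0.
  by rewrite /L !big1 ?subrr // => k _; rewrite ffunE.
have L_orbit v : L (orbit_family v) = 0.
  have /KH/(_ _ Hh) hS := trace_fixed K v sKG.
  rewrite -[RHS](subrr (\sum_(k in K) rho k v)) -[X in _ = _ - X]hS /L.
  congr (_ - _); first by apply: eq_bigr => k Kk; rewrite ffunE (GK k).
  rewrite (lin_sum (rho_lin h Gh)); apply: eq_bigr => k Kk.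
  by rewrite ffunE groupM ?(GK k) // rhoM ?(GK k).
have Fmode := @family_mode_algebra _ _ gT _ Ymode.
(* Stability of [D] under constant families follows by locality, since [L] commutes with their
   modes; under orbit families, by associativity, since these are closed under modes. *)
pose D d := forall u n, L (family_mode Y (orbit_family u) n d) = 0.
have D_all x : exists d, [/\ D d, forall g, g \in G :\ 1%g -> d g = 0 &
    forall g, g \in G -> (forall w, True -> rho g w = w) -> d g = x].
  apply: (separate (fun=> True)) => [|a n d Dd u m|u n d _ Dd w m|u n||g].
  - split=> [u n|a d d' Dd Dd' u n]; last by rewrite (mode_linr Fmode) L_lin Dd Dd' scaler0 addr0.
    by rewrite (mode0r Fmode); case: Lsub.
  - apply: (mode_swap_subspace Fmode _ Lsub) => p q.
    have LY e : L (family_mode Y [ffun=> a] p e) = Y a p (L e).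
      rewrite /L (linB (mode_linr Ymode a p)) !(lin_sum (mode_linr Ymode a p)).
      by congr (_ - _); apply: eq_bigr => k _; rewrite !ffunE.
    by rewrite LY Dd (mode0r Ymode).
  - apply: (mode_assoc_subspace Fmode _ Lsub) => s t.
    by rewrite orbit_family_mode.
  - rewrite -[RHS](L_orbit (Y u n one)) -orbit_family_mode /L.
    have oneE k : k \in G -> family_mode Y (orbit_family u) n [ffun=> one] k =
        family_mode Y (orbit_family u) n (orbit_family one) k.
      by move=> Gk; rewrite !ffunE Gk rho_one.
    by congr (_ - _); apply: eq_bigr => k /GK Gk; rewrite oneE // groupM.
  - by rewrite subD1set.
  rewrite !inE => /andP[g1 Gg]; apply: contrapT => gfix.
  case/eqP: g1; apply: faithful => // v; apply: contrapT => /eqP gv.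
  by apply: gfix; exists v.
(* On a family that is [x] at 1 and 0 on the rest of [G], [L] returns [x]: hk = 1 with [k] in [K]
   would put [h] in [K]. *)
have V0 (x : V) : x = 0.
  have [d [Dd dS /(_ _ (group1 G))]] := D_all x; move=> <- //; last by move=> w _; apply: rho1.
  have := Dd one (-1); rewrite /L (bigD1 1%g) //= !big1 ?addr0 ?subr0 => [|k Kk|k /andP[Kk k1]].
  - by rewrite !ffunE group1 rho_one // vacuum eqxx.
  - rewrite ffunE dS ?(mode0r Ymode) // !inE groupM ?(GK k) // andbT.
    by apply: contra nKh => /eqP/(canRL (mulgK _)) ->; rewrite mul1g groupV.
  - by rewrite ffunE dS ?(mode0r Ymode) // !inE k1 (GK k).
by case/negP: nKh; rewrite (faithful h) // => v; rewrite (V0 v); apply: V0.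
Qed.

(** * Surjectivity of the correspondence *)

Lemma fixed_points_surj (W : V -> Prop) :
  is_subspace W -> W one -> (forall u v n, W u -> W v -> W (Y u n v)) ->
  (forall v, fixed_points rho G v -> W v) ->
  exists2 H : {group gT}, H \subset G & (forall v, W v <-> fixed_points rho H v).
Proof.
move=> Wsub Wone WY WG; pose Hset := [set g in G | `[< forall w, W w -> rho g w = w >]].
have HP g : reflect (g \in G /\ forall w, W w -> rho g w = w) (g \in Hset).
  by rewrite inE; apply: (iffP andP) => -[Gg /asboolP].
have Hgroup : group_set Hset.
  apply/group_setP; split=> [|g h /HP[Gg gW] /HP[Gh hW]]; first by apply/HP; split=> // w _; apply: rho1.
  by apply/HP; split=> [|w Ww]; rewrite ?groupM // rhoM // hW ?gW.
exists (group Hgroup) => [|x]; first by apply/subsetP=> g /HP[].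
split=> [Wx g /HP[_]|Hx]; first exact.
(* The inverse index makes [T] turn modes of [orbit_family u] into modes of [u]: g ((g^-1 u)_p e) =
   u_p (g e). *)
pose T (d : {ffun gT -> V}) := \sum_(g in G) rho g (d g^-1%g).
have Tsub : is_subspace (fun d => W (T d)).
  split=> [|a d d' Wd Wd'].
    rewrite /T big1 => [|g Gg]; first exact: (subspace0 Wsub).
    by rewrite ffunE (lin0 (rho_lin g Gg)).
  suff -> : T (a *: d + d') = a *: T d + T d' by apply: Wsub.2.
  rewrite /T scaler_sumr -big_split /=.
  by apply: eq_bigr => g Gg; rewrite !ffunE (rho_lin g Gg).
have Fmode := @family_mode_algebra _ _ gT _ Ymode.
pose D d := forall a p, W (T (family_mode Y [ffun=> a] p d)).
have [|a n d Dd u m|u n d Wu Dd a m|a n||g|d [Dd dS dH]] :=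
    @separate W D _ _ _ _ (G :\: Hset) x.
- split=> [a p|c d d' Dd Dd' a p]; last by rewrite (mode_linr Fmode); apply: Tsub.2.
  by rewrite (mode0r Fmode); apply: Tsub.1.
- apply: (mode_assoc_subspace Fmode _ Tsub) => s t.
  by rewrite family_mode_const.
- apply: (mode_swap_subspace Fmode _ Tsub) => p q.
  suff -> e : T (family_mode Y (orbit_family u) p e) = Y u p (T e) by apply: WY.
  rewrite /T (lin_sum (mode_linr Ymode u p)); apply: eq_bigr => g Gg.
  by rewrite !ffunE groupV Gg rho_mode // -rhoM ?groupV // mulgV rho1.
(* Here V^G in [W] enters: the sum of the (g a)_n 1 is a mode of the trace of [a]. *)
- rewrite family_mode_const /T.
  under eq_bigr => g Gg do rewrite ffunE rho_mode // rho_one //.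
  by rewrite -(lin_sum (mode_linl Ymode n one)); apply: WY => //; apply: WG; apply: trace_fixed.
- by rewrite subsetDl.
- rewrite inE => /andP[nHg Gg]; apply: contrapT => gfix.
  case/HP: nHg; split=> // w Ww; apply: contrapT => /eqP gw.
  by apply: gfix; exists w.
(* The mode 1_(-1) is the identity, so [T d] lies in [W]. Its terms are g x = x for [g] in [Hset]
   and 0 otherwise. *)
have := Dd one (-1).
rewrite /T (bigID (mem Hset)) /= [X in _ + X]big1 ?addr0 => [|g /andP[Gg nHg]]; last first.
  have nHV : g^-1%g \notin Hset by rewrite -[Hset]/(gval (group Hgroup)) groupV.
  by rewrite !ffunE dS ?(mode0r Ymode) ?(lin0 (rho_lin g Gg)) // inE nHV groupV.
rewrite (eq_bigr (fun=> x)) => [|g /andP[Gg Hg]]; last first.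
  have /HP[GV HV] : g^-1%g \in Hset by rewrite -[Hset]/(gval (group Hgroup)) groupV.
  by rewrite !ffunE dH // vacuum eqxx Hx.
rewrite (eq_bigl (mem Hset)) => [|g]; last first.
  by apply/andP/idP => [[]|Hg] //; split=> //; case/HP: Hg.
rewrite sumr_const -scaler_nat => /(subspaceZ Wsub #|Hset|%:R^-1 _).
rewrite scalerA mulVf ?scale1r // pnatr_eq0 -lt0n.
exact: (cardG_gt0 (group Hgroup)).
Qed.

End Galois.

(** * Automorphisms and the grading; assembling the correspondence *)

(** Fixing [omega], [g] commutes with L(0), whose eigenspaces for the distinct eigenvalues [n] are
    the homogeneous spaces. *)
Lemma aut_grading (R : realType) (V : lmodType R[i]) (pi : int -> V -> V) Y one omega c g :
  is_VOA pi Y one omega c -> is_VOA_aut Y one omega g ->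
  forall n v, g (pi n v) = pi n (g v).
Proof.
case=> [[[[pi_lin pi_pi pi_dec _] _] _ YR _ _] [_ L0_pi _]] [g_lin _ gY _ g_omega] n v.
pose L0 := Vir Y omega 0.
have L0_lin : forall a u w, L0 (a *: u + w) = a *: L0 u + L0 w by apply: YR.
have L0_eig : forall n v, pi n v = v -> L0 v = n%:~R *: v := L0_pi.
have pi_L0 k u : pi k (L0 u) = k%:~R *: pi k u.
  have [s [_ us]] := pi_dec u.
  rewrite {1}us {2}us (lin_sum L0_lin) !(lin_sum (pi_lin k)) scaler_sumr; apply: eq_bigr => m _.
  rewrite (L0_eig m) ?pi_pi ?eqxx // (linZ (pi_lin k)) pi_pi.
  by case: eqP => [->|_]; rewrite ?scaler0.
have pi_g m u : pi m u = u -> forall k, pi k (g u) = if k == m then g u else 0.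
  move=> um; have L0g : L0 (g u) = m%:~R *: g u.
    rewrite /L0 /Vir -g_omega -gY -[Y _ _ u]/(L0 u) (L0_eig m) //.
    by rewrite (linZ g_lin).
  have piN k : k != m -> pi k (g u) = 0.
    move=> km; have := pi_L0 k (g u); rewrite L0g (linZ (pi_lin k)) => /eqP; rewrite -subr_eq0 -scalerBl.
    by rewrite -intrB scaler_eq0 intr_eq0 subr_eq0 eq_sym (negPf km) => /eqP.
  move=> k; case: eqP => [->|/eqP/piN //].
  have [s [_ gus]] := pi_dec (g u).
  (* A priori [s] may repeat or omit [m], so only proportionality is read off; idempotence of [pi m]
     then gives equality. *)
  have [mu gu] : exists a : R[i], g u = a *: pi m (g u).
    exists (\sum_(i <- s) (i == m)%:R).
    rewrite scaler_suml {1}gus; apply: eq_bigr => i _.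
    by have [->|/piN ->] := eqVneq i m; rewrite ?scale1r ?scale0r.
  by rewrite {1}gu (linZ (pi_lin m)) pi_pi eqxx -gu.
have [s [_ vs]] := pi_dec v.
rewrite {1}vs {2}vs (lin_sum g_lin) !(lin_sum (pi_lin n)) (lin_sum g_lin).
apply: eq_bigr => m _; rewrite (pi_g m) ?pi_pi ?eqxx //.
by case: eqP => _ //; apply: (lin0 g_lin).
Qed.

Theorem theorem1 (R : realType) (V : lmodType R[i])
    (pi : int -> V -> V) (Y : V -> int -> V -> V) (one omega : V) (c : R[i])
    (gT : finGroupType) (G : {group gT}) (rho : gT -> V -> V) :
  is_VOA pi Y one omega c ->
  simple_VOA Y ->
  (* G acts on V by VOA automorphisms ... *)
  (forall g, g \in G -> is_VOA_aut Y one omega (rho g)) ->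
  (forall g h v, g \in G -> h \in G -> rho (g * h)%g v = rho g (rho h v)) ->
  (* ... faithfully *)
  (forall g, g \in G -> (forall v, rho g v = v) -> g = 1%g) ->
  abelian G \/ dihedral G ->
  (* H |-> V^H is a bijection from subgroups of G onto sub VOAs containing V^G *)
  [/\ (forall H : {group gT}, H \subset G ->
         is_subVOA pi Y one omega (fixed_points rho H) /\
         (forall v, fixed_points rho G v -> fixed_points rho H v)),
      (forall H1 H2 : {group gT}, H1 \subset G -> H2 \subset G ->
         (forall v, fixed_points rho H1 v <-> fixed_points rho H2 v) -> H1 = H2) &
      (forall W : V -> Prop, is_subVOA pi Y one omega W ->
         (forall v, fixed_points rho G v -> W v) ->
         exists2 H : {group gT}, H \subset G &
           (forall v, W v <-> fixed_points rho H v))].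
Proof.
move=> VOA Ysimple rho_aut rhoM faithful _.
have [[_ YL YR Ytr [vacuum creation _ jac]] _] := VOA.
have Ymode : mode_algebra Y by split.
have inj := fixed_points_inj Y one omega Ymode vacuum creation Ysimple rho_aut rhoM.
split=> [H /subsetP sHG|H K sHG sKG HK|W [Wsub _ Wone _ WY] WG].
- split=> [|v Gv h Hh]; last by apply/Gv/sHG.
  split=> [|n w Hw h Hh|h Hh|h Hh|u v n Hu Hv h Hh].
  + split=> [h Hh|a u v Hu Hv h Hh]; first exact: (lin0 (rho_lin Y one omega rho_aut h (sHG h Hh))).
    by have [g_lin _ _ _ _] := rho_aut h (sHG h Hh); rewrite g_lin Hu ?Hv.
  + by rewrite (aut_grading _ _ _ _ _ _ _ _ VOA (rho_aut h (sHG h Hh))) Hw.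
  + by have [] := rho_aut h (sHG h Hh).
  + by have [] := rho_aut h (sHG h Hh).
  + by have [_ _ gY _ _] := rho_aut h (sHG h Hh); rewrite gY Hu ?Hv.
- by apply/group_inj/eqP; rewrite eqEsubset; apply/andP;
    split; apply: inj => // v /HK.
- exact: (fixed_points_surj _ _ _ Ymode vacuum creation Ysimple rho_aut rhoM W Wsub Wone WY WG).
Qed.
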